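(* Let $G$ be a connected $\Delta$-regular graph with $\Delta\le 5$ and let $G^*$ be another graph. If $A(G^*;x)=A(G;x)$, then $G^*$ is a $\Delta$-regular graph with the same order and size as $G$.
   Context: Graphs are finite, simple, nonempty, and not necessarily connected; the order is the number of vertices and the size is the number of edges. For a graph $G=(V,E)$ with order $n$ and maximum degree $\Delta$, and $X\subseteq V$, $\delta_X(v)$ is the number of neighbours of $v$ in $X$, $\overline{X}=V\setminus X$, and $\langle X\rangle$ is the induced subgraph. $G$ is $\Delta$-regular if all its vertices have degree $\Delta$. For a nonempty $S\subseteq V$ with $\langle S\rangle$ connected, and an integer $k\in[-\Delta,\Delta]$, $S$ is a defensive $k$-alliance if $\delta_S(v)\ge\delta_{\overline S}(v)+k$ for every $v\in S$; the exact index of alliance of $S$ is $k_S=\max\{k\in[-\Delta,\Delta]\cap\mathbb Z: S\text{ is a defensive }k\text{-alliance}\}=\min_{v\in S}\{\delta_S(v)-\delta_{\overline S}(v)\}$, and $S$ is called an exact defensive $k_S$-alliance. $A_k(G)$ denotes the number of exact defensive $k$-alliances in $G$ (subsets $S\subseteq V$), and the alliance polynomial of $G$ is $A(G;x)=\sum_{k=-\Delta}^{\Delta}A_k(G)\,x^{n+k}$ (where $n$ and $\Delta$ are the order and maximum degree of the graph in question). *)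

(* Defs.v *)
From HB Require Import structures.
From mathcomp Require Import all_boot all_order all_algebra.
From mathcomp Require Import zify.

Set Implicit Arguments.
Unset Strict Implicit.
Unset Printing Implicit Defensive.

Import Order.TTheory GRing.Theory Num.Theory.
Local Open Scope ring_scope.

Record graph := Graph {
  vertex :> finType;
  adj : rel vertex;
  adj_sym : symmetric adj;
  adj_irrefl : irreflexive adj;
  vertex_nonempty : (0 < #|vertex|)%N
}.

Section Graphs.
Variable G : graph.
Implicit Types (X S : {set G}) (v : G) (k : int).

Definition edges : {set {set G}} :=
  [set [set p.1; p.2] | p in [set p : G * G | adj p.1 p.2]].

Definition deg_in X v : nat := #|[set w in X | adj v w]|.

Definition degree v : nat := deg_in [set: G] v.

Definition max_degree : nat := \max_(v : G) degree v.

Definition regular (d : nat) : Prop := forall v : G, degree v = d.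

Definition induced_adj X : rel G :=
  [rel x y | [&& x \in X, y \in X & adj x y]].

(* True for X = set0: non-emptiness is required separately where needed. *)
Definition connected_in X : bool :=
  [forall x in X, forall y in X, connect (induced_adj X) x y].

Definition connected : bool := connected_in [set: G].

Definition index_range : seq int :=
  [seq j%:Z - max_degree%:Z | j <- iota 0 (2 * max_degree).+1].

Definition defensive_alliance k S : bool :=
  [&& S != set0, connected_in S, k \in index_range &
      [forall v in S, (deg_in (~: S) v)%:Z + k <= (deg_in S v)%:Z]].

(* The default value - max_degree does not interfere: every non-empty S
   inducing a connected subgraph is a defensive (- max_degree)-alliance. *)
Definition exact_index S : int :=
  \big[Num.max/ - max_degree%:Z]_(k <- index_range | defensive_alliance k S) k.

Definition exact_alliance k S : bool :=
  defensive_alliance k S && (exact_index S == k).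

Definition num_exact k : nat := #|[set S : {set G} | exact_alliance k S]|.

(* The absolute value only converts #|G| + k, which is nonnegative (indeed
   positive) for k in index_range, to a natural number; see exponentE. *)
Definition alliance_poly : {poly int} :=
  \sum_(k <- index_range) (num_exact k)%:R *: 'X^(absz (#|G|%:Z + k)).

Lemma mem_index_range k :
  (k \in index_range) = (- max_degree%:Z <= k <= max_degree%:Z).
Proof.
apply/mapP/idP => [[j]|kr]; first by rewrite mem_iota => ? ->; lia.
by exists (absz (k + max_degree%:Z)); [rewrite mem_iota|]; lia.
Qed.

Lemma max_degree_lt : (max_degree < #|G|)%N.
Proof.
rewrite /max_degree -(prednK (vertex_nonempty G)) ltnS.
apply/bigmax_leqP => v _; rewrite -ltnS (prednK (vertex_nonempty G)).
rewrite -cardsT; apply: proper_card; apply/properP; split.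
  exact: subsetT.
by exists v; rewrite !inE // adj_irrefl.
Qed.

Lemma exponentE k : k \in index_range ->
  (absz (#|G|%:Z + k))%:Z = #|G|%:Z + k.
Proof. by rewrite mem_index_range; have := max_degree_lt; lia. Qed.

Lemma deg_inC S v : (deg_in S v + deg_in (~: S) v)%N = degree v.
Proof.
rewrite /degree /deg_in -[in RHS](cardsID S); congr (_ + _)%N;
  by apply: eq_card => w; rewrite !inE // andbC.
Qed.

(* exact_index S is the minimum over S of the difference of the degrees. *)
Lemma exact_indexP S k : S != set0 -> connected_in S ->
  (exact_index S == k) =
  [forall v in S, k <= (deg_in S v)%:Z - (deg_in (~: S) v)%:Z] &&
  [exists v in S, k == (deg_in S v)%:Z - (deg_in (~: S) v)%:Z].
Proof.
move=> S0 cS; pose f v := (deg_in S v)%:Z - (deg_in (~: S) v)%:Z.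
have fb v : - max_degree%:Z <= f v <= max_degree%:Z.
  have : (degree v <= max_degree)%N by rewrite /max_degree (leq_bigmax v).
  by rewrite -(deg_inC S) /f; lia.
have [v0 v0S] := set0Pn _ S0.
have [m mS mmin] := @arg_minP _ _ _ v0 (mem S) f v0S.
have daE j : j \in index_range -> defensive_alliance j S = (j <= f m).
  move=> jr; rewrite /defensive_alliance S0 cS jr /=.
  apply/forall_inP/idP => [/(_ m mS)|jm v vS]; first by rewrite /f; lia.
  by have := le_trans jm (mmin v vS); rewrite /f; lia.
have fr : f m \in index_range by rewrite mem_index_range.
have -> : exact_index S = f m.
  apply/eqP; rewrite eq_le; apply/andP; split.
    rewrite /exact_index big_seq_cond.
    elim/big_ind: _ => [|x y xm ym|j /andP[jr]]; first by case/andP: (fb m).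
      by rewrite ge_max xm.
    by rewrite daE.
  by apply: (@le_bigmax_seq _ _ _ _ _ (f m)) => //; rewrite daE.
apply/eqP/andP => [<-|[/forall_inP kmin /exists_inP[v vS /eqP kE]]].
  split; first by apply/forall_inP => v vS; apply: mmin.
  by apply/exists_inP; exists m.
by apply/eqP; rewrite eq_le kmin // kE mmin.
Qed.

End Graphs.

(* Main.v *)
(* Comparing lowest terms, G* has order n + t and maximum degree Delta + t with
   t >= 0, and exactly n = |G| of its vertices, forming a set H, have maximum
   degree.  If t = 0 then H is everything.  Suppose t > 0 and let L be the
   complement of H, so |L| = t.  As G is connected and regular, the highest term
   says that exactly one connected S in G* has the largest index Delta - t, and
   the other indices are at most Delta - t - 2.  Every vertex of H has at least
   Delta neighbours in H, so that S is H, and every nonempty set of vertices of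
   index greater than Delta - t - 2, connected or not, contains H.  Applied to
   H - v, H + w and the whole graph, this forces Delta = 5, t = 1 and L = {w},
   where w has exactly two neighbours a, b.  Applied to H - u it shows that every
   u in H is adjacent to a or b (so a and b are adjacent), and applied to
   H - {a, b} that a and b have a common neighbour, hence n <= 9.  For such n, a
   5-regular graph has at most n exact 3-alliances (the complements of vertices),
   whereas G* has at least 2(n - 2) > n exact 2-alliances. *)

Require Import Defs.
From mathcomp Require Import all_boot all_order all_algebra.
From mathcomp Require Import zify.

Set Implicit Arguments.
Unset Strict Implicit.
Unset Printing Implicit Defensive.

Import Order.TTheory GRing.Theory Num.Theory.

(** * Degrees into a set, and double counting *)

Section GraphTheory.
Variable G : graph.
Implicit Types (X S : {set G}) (u v w : G).

(** The degrees into [S] and into its complement add up to [degree v], so this is their difference,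
    written without the complement. *)
Definition index_at S v : int := ((2 * deg_in S v)%:Z - (degree v)%:Z)%R.

Lemma deg_in_le S v : deg_in S v <= degree v.
Proof. by rewrite -(deg_inC S) leq_addr. Qed.

Lemma degree_le_max v : degree v <= max_degree G.
Proof. exact: leq_bigmax. Qed.

Lemma exists_max_degree : exists v, degree v = max_degree G.
Proof.
have [v _ e] := @eq_bigmax_cond G predT (@degree G) (vertex_nonempty G).
by exists v; rewrite /max_degree e.
Qed.

Lemma deg_in_sub X S v : X \subset S -> deg_in X v <= deg_in S v.
Proof.
move=> /subsetP s; apply: subset_leq_card.
by apply/subsetP => w; rewrite !inE => /andP[/s -> ->].
Qed.

Lemma deg_in_card X v : deg_in X v <= #|X|.
Proof. by apply: subset_leq_card; apply/subsetP => w; rewrite !inE => /andP[]. Qed.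

Lemma deg_in_cardS X v : v \in X -> deg_in X v < #|X|.
Proof.
move=> vX; apply: proper_card; apply/properP; split.
  by apply/subsetP => w; rewrite !inE => /andP[].
by exists v => //; rewrite !inE adj_irrefl andbF.
Qed.

Lemma deg_in_full X v : deg_in X v = #|X| -> {in X, forall w, adj v w}.
Proof.
move=> e w wX; have : X \subset [set w in X | adj v w].
  have s : [set w in X | adj v w] \subset X
    by apply/subsetP => x; rewrite !inE => /andP[].
  by have [_ <-] := subset_leqif_card s; apply/eqP.
by move/subsetP/(_ w wX); rewrite inE => /andP[].
Qed.

Lemma deg_inD1 X u v : deg_in X v = ((u \in X) && adj v u) + deg_in (X :\ u) v.
Proof.
rewrite /deg_in (cardsD1 u) !inE; congr (_ + _).
by apply: eq_card => w; rewrite !inE andbA.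
Qed.

Lemma deg_in1 u v : deg_in [set u] v = adj v u.
Proof.
have /eqP d0 : deg_in set0 v == 0 by rewrite -leqn0 -(cards0 G) deg_in_card.
by rewrite (deg_inD1 _ u) inE eqxx setDv d0 addn0.
Qed.

Lemma sum_deg_in_swap X S : \sum_(v in X) deg_in S v = \sum_(v in S) deg_in X v.
Proof.
have E A B : \sum_(v in A) deg_in B v = \sum_(v in A) \sum_(w in B) adj v w.
  apply: eq_bigr => v _; rewrite /deg_in -sum1_card big_mkcond [RHS]big_mkcond.
  by apply: eq_bigr => w _; rewrite inE; case: (w \in B); case: (adj v w).
rewrite !E exchange_big; apply: eq_bigr => v _; apply: eq_bigr => w _.
by rewrite adj_sym.
Qed.

(** Counts the incident pairs of a vertex and an edge. An edge is a set of two vertices by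
    irreflexivity, and the neighbours of [v] correspond to the edges containing [v]. *)
Lemma handshake : \sum_(v : G) degree v = 2 * #|edges G|.
Proof.
have edgeP v w : ([set v; w] \in edges G) = adj v w.
  apply/imsetP/idP => [[[x y]]|avw]; last by exists (v, w); rewrite ?inE.
  rewrite inE /= => axy e.
  have : (x \in [set v; w]) && (y \in [set v; w]) by rewrite e !inE !eqxx orbT.
  have nxy : x != y by apply: contraTneq axy => ->; rewrite adj_irrefl.
  rewrite !inE => /andP[/orP[]/eqP ex /orP[]/eqP ey]; subst => //.
  - by rewrite eqxx in nxy.
  - by rewrite adj_sym.
  by rewrite eqxx in nxy.
have degE v : degree v = \sum_(e in edges G) (v \in e).
  have -> : degree v = #|[set [set v; w] | w in [set w in [set: G] | adj v w]]|.
    rewrite card_in_imset // => x y; rewrite !inE /= => ax ay /setP e.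
    have := e x; rewrite !inE eqxx orbT => /esym/orP[]/eqP // xv.
    by move: ax; rewrite xv adj_irrefl.
  rewrite -sum1_card big_mkcond [RHS]big_mkcond; apply: eq_bigr => e _.
  rewrite (_ : (e \in _ @: _) = (e \in edges G) && (v \in e)).
    by case: (e \in edges G); case: (v \in e).
  apply/imsetP/andP => [[w]|[/imsetP[[x y]]]]; rewrite !inE /=.
    by move=> avw ->; rewrite edgeP avw !inE eqxx.
  move=> axy ->; rewrite !inE => /orP[]/eqP ->; first by exists y; rewrite ?inE.
  by exists x; rewrite ?inE 1?adj_sym // setUC.
under eq_bigr => v _ do rewrite degE.
rewrite exchange_big mulnC -sum_nat_const; apply: eq_bigr => e /=.
case/imsetP => -[x y]; rewrite inE /= => axy ->.
rewrite (_ : \sum_v _ = #|[set x; y]|).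
  by rewrite cards2; case: eqP axy => // ->; rewrite adj_irrefl.
by rewrite -sum1_card [RHS]big_mkcond.
Qed.

(** * Exact alliances and the coefficients of the polynomial *)

Lemma exact_allianceE k S : exact_alliance k S =
  [&& S != set0, connected_in S, [forall v in S, k <= index_at S v]%R &
      [exists v in S, k == index_at S v]].
Proof.
have ix v : index_at S v = ((deg_in S v)%:Z - (deg_in (~: S) v)%:Z)%R.
  by have := deg_inC S v; rewrite /index_at; lia.
rewrite /exact_alliance /defensive_alliance.
have [S0|] := boolP (S != set0) => //=; have [cS|] := boolP (connected_in S) => //=.
rewrite exact_indexP // mem_index_range.
apply/andP/andP => [[_ /andP[/forall_inP a /exists_inP[v vS b]]]|
                    [/forall_inP a /exists_inP[v vS b]]].
  split; [apply/forall_inP => u uS; rewrite ix; exact: a|].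
  by apply/exists_inP; exists v; rewrite ?ix.
split; [apply/andP; split|apply/andP; split].
(* As [k] is attained at [v], its absolute value is at most [degree v], which puts it in the
   range. *)
- rewrite (eqP b) /index_at.
  by have := deg_in_le S v; have := degree_le_max v; lia.
- apply/forall_inP => u uS; have := a u uS; rewrite /index_at.
  by have := deg_inC S u; lia.
- by apply/forall_inP => u uS; rewrite -ix; apply: a.
by apply/exists_inP; exists v; rewrite -?ix.
Qed.

Lemma exists_exact_index S : S != set0 -> connected_in S ->
  exists2 k, exact_alliance k S & exists2 v, v \in S & k = index_at S v.
Proof.
move=> S0 cS; have [v0 v0S] := set0Pn _ S0.
have [v vS vmin] := @arg_minP _ _ _ v0 (mem S) (index_at S) v0S.
exists (index_at S v); last by exists v.
rewrite exact_allianceE S0 cS /=; apply/andP; split; first by apply/forall_inP.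
by apply/exists_inP; exists v.
Qed.

Lemma num_exact_gt0 k : (0 < num_exact G k) = [exists S : {set G}, exact_alliance k S].
Proof.
by apply/card_gt0P/existsP => -[S]; [rewrite inE|]; exists S; rewrite ?inE.
Qed.

(** Distinct indices have distinct exponents, so at most one summand contributes. Outside
    [index_range] there is none, and [num_exact] vanishes too. *)
Lemma coef_alliance_poly j :
  ((alliance_poly G)`_j)%R = (num_exact G (j%:Z - #|G|%:Z))%:R%R.
Proof.
rewrite /alliance_poly coef_sum.
have uniqr : uniq (index_range G).
  by rewrite map_inj_uniq ?iota_uniq // => x y; lia.
have E k : k \in index_range G ->
    (((num_exact G k)%:R *: 'X^(absz (#|G|%:Z + k))%R : {poly int})`_j)%R =
    (if k == (j%:Z - #|G|%:Z)%R then (num_exact G k)%:R else 0)%R.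
  move=> kr; have := exponentE kr; rewrite coefZ coefXn => e.
  rewrite (_ : (j == _) = (k == (j%:Z - #|G|%:Z)%R)); last by lia.
  by case: ifP => _; rewrite ?mulr1 ?mulr0.
rewrite (eq_big_seq _ E) -big_mkcond /=.
have [kr|kr] := boolP ((j%:Z - #|G|%:Z)%R \in index_range G).
  by rewrite -big_filter (filter_pred1_uniq uniqr kr) big_seq1.
rewrite big_seq_cond big1 => [|k /andP[kr' /eqP e]]; last by rewrite -e kr' in kr.
suff -> : num_exact G (j%:Z - #|G|%:Z)%R = 0 by [].
apply/eqP; rewrite -leqn0 leqNgt num_exact_gt0; apply/existsP => -[S].
rewrite /exact_alliance /defensive_alliance => /andP[/and4P[_ _ kr' _] _].
by rewrite kr' in kr.
Qed.

(** A vertex attaining this index has maximum degree and no neighbour in [S], so a connected [S] is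
    that single vertex. *)
Lemma num_exact_min_degree :
  num_exact G (- (max_degree G)%:Z)%R = #|[set v : G | degree v == max_degree G]|.
Proof.
rewrite -(card_imset _ set1_inj) /num_exact; apply: eq_card => S.
rewrite inE exact_allianceE; apply/and4P/imsetP => [[_ cS a /exists_inP[v vS /eqP e]]|[v]].
  have dl := deg_in_le S v; have dm := degree_le_max v.
  rewrite /index_at in e.
  exists v; first by rewrite inE; apply/eqP; lia.
  apply/setP => w; rewrite inE; apply/idP/eqP => [wS|-> //].
  have /connectP[[|x p] /= pth ->] // := forall_inP (forall_inP cS v vS) w wS.
  case/andP: pth => /and3P[_ xS avx] _.
  have : 0 < deg_in S v by apply/card_gt0P; exists x; rewrite inE xS.
  by lia.
rewrite inE => /eqP dv ->; have d0 : deg_in [set v] v = 0 by rewrite deg_in1 adj_irrefl.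
split; first by apply/set0Pn; exists v; rewrite set11.
- by apply/forall_inP => x /set1P ->; apply/forall_inP => y /set1P ->.
- by apply/forall_inP => x /set1P ->; rewrite /index_at d0 dv; lia.
by apply/exists_inP; exists v; rewrite ?set11 // /index_at d0 dv; lia.
Qed.

(** * Components and connectedness *)

Lemma induced_adj_sym X : connect_sym (induced_adj X).
Proof.
by apply: sym_connect_sym => x y; rewrite /induced_adj /= adj_sym andbCA.
Qed.

Definition component X v : {set G} := [set w in X | connect (induced_adj X) v w].

Lemma component_sub X v : component X v \subset X.
Proof. by apply/subsetP => w; rewrite inE => /andP[]. Qed.

Lemma mem_component X v : v \in X -> v \in component X v.
Proof. by move=> vX; rewrite inE vX /=. Qed.

(** Neighbours in [X] of a vertex of a component stay in it. Hence bounds on the index in an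
    arbitrary set pass to a connected one. *)
Lemma deg_in_component X v w : w \in component X v ->
  deg_in (component X v) w = deg_in X w.
Proof.
rewrite inE => /andP[wX cvw]; apply: eq_card => x; rewrite !inE.
apply/andP/andP => [[/andP[-> _] ->] //|[xX awx]]; rewrite xX awx /=; split=> //.
by apply: connect_trans cvw (connect1 _); rewrite /induced_adj /= wX xX.
Qed.

Lemma connected_component X v : v \in X -> connected_in (component X v).
Proof.
move=> vX; have C x : x \in component X v ->
    connect (induced_adj (component X v)) v x.
  rewrite inE => /andP[_ /connectP[p pth ->]].
  suff gen a : a \in component X v -> path (induced_adj X) a p ->
      connect (induced_adj (component X v)) a (last a p).
    exact: gen (mem_component vX) pth.
  elim: p a {pth} => [|y p IH] a aC //= /andP[axy pth].
  have yC : y \in component X v.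
    move: axy aC; rewrite !inE /= => /and3P[aX yX ay] /andP[_ cva].
    by rewrite yX; apply: connect_trans cva (connect1 _); rewrite /induced_adj /= aX yX.
  apply: connect_trans (IH y yC pth); apply: connect1.
  by case/and3P: axy => _ _ ay; rewrite /induced_adj /= aC yC.
apply/forall_inP => x /C cx; apply/forall_inP => y /C cy.
by apply: connect_trans cy; rewrite induced_adj_sym.
Qed.

Lemma connected_dominated S a :
  {in S, forall v, connect (induced_adj S) a v} -> connected_in S.
Proof.
move=> h; apply/forall_inP => x /h cx; apply/forall_inP => y /h cy.
by apply: connect_trans cy; rewrite induced_adj_sym.
Qed.

Lemma connected_edge_dominated S a b : a \in S -> b \in S -> adj a b ->
  {in S, forall v, (adj v a) || (adj v b)} -> connected_in S.
Proof.
move=> aS bS ab h; apply: (@connected_dominated S a) => v vS.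
have [va|] := boolP (adj v a); first by apply: connect1; rewrite /induced_adj /= aS vS adj_sym.
have := h v vS; case: (adj v a) => //= vb _.
apply: (@connect_trans _ _ b); apply: connect1; first by rewrite /induced_adj /= aS bS.
by rewrite /induced_adj /= bS vS adj_sym.
Qed.

Lemma connected_setU1 S a w : connected_in S -> a \in S -> adj w a ->
  connected_in (w |: S).
Proof.
move=> cS aS wa; have sub : subrel (induced_adj S) (connect (induced_adj (w |: S))).
  move=> x y /and3P[xS yS xy]; apply: connect1.
  by rewrite /induced_adj /= !inE xS yS !orbT.
apply: (@connected_dominated _ a) => v /setU1P[->|vS].
  by apply: connect1; rewrite /induced_adj /= !inE aS eqxx orbT adj_sym wa.
by apply: (connect_sub sub); apply: (forall_inP (forall_inP cS a aS)).
Qed.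

End GraphTheory.

(** * Exact alliances in regular graphs *)

Section Regular.
Variables (G : graph) (D : nat).
Hypothesis regG : regular G D.

Lemma max_degree_regular : max_degree G = D.
Proof. by have [v <-] := exists_max_degree G. Qed.

Lemma exact_regular k (S : {set G}) : exact_alliance k S ->
  exists2 d, d <= D & k = ((2 * d)%:Z - D%:Z)%R.
Proof.
rewrite exact_allianceE => /and4P[_ _ _ /exists_inP[v _ /eqP ->]].
by exists (deg_in S v); [rewrite -(regG v) deg_in_le|rewrite /index_at regG].
Qed.

(** At index [D] no vertex of [S] has a neighbour outside, so [S] is closed under adjacency. *)
Lemma exact_regular_top (S : {set G}) : connected G -> exact_alliance D%:Z S ->
  S = [set: G].
Proof.
move=> /forall_inP cG; rewrite exact_allianceE => /and4P[/set0Pn[v vS] _ /forall_inP a _].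
have full x : x \in S -> forall y, adj x y -> y \in S.
  move=> xS y xy; have := a x xS; have := deg_inC S x; rewrite /index_at regG => e1 e2.
  have : deg_in (~: S) x = 0 by lia.
  by move/card0_eq/(_ y); rewrite !inE xy andbT => /negbFE.
apply/setP => x; rewrite inE.
have /forall_inP/(_ x (in_setT x))/connectP[p] := cG v (in_setT v).
by elim: p v vS => [|y p IH] v vS /= => [_ ->|/andP[/and3P[_ _ vy]]] //; apply/IH/(full v).
Qed.

(** Counts the edges between [S] and its complement, of size m. A vertex of [S] sends out at most
    one, so there are at most 9 - m; a vertex outside has at most m - 1 neighbours outside, so there
    are at least m(6 - m). *)
Lemma exact_regular_near_top (S : {set G}) : D = 5 -> #|G| <= 9 ->
  exact_alliance 3%:Z S -> #|~: S| = 1.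
Proof.
move=> D5 n9; rewrite exact_allianceE => /and4P[_ _ /forall_inP a /exists_inP[v vS /eqP e]].
have dv := regG v; rewrite D5 in dv.
have in4 x : x \in S -> deg_in (~: S) x <= 1.
  move=> xS; have := a x xS; have := deg_inC S x; rewrite /index_at regG D5.
  by lia.
have v4 : deg_in S v = 4 by move: e; rewrite /index_at dv; lia.
have cv := deg_in_cardS vS.
have X1 : 0 < #|~: S|.
  by have := deg_inC S v; have := deg_in_card (~: S) v; lia.
have up : \sum_(x in S) deg_in (~: S) x <= #|S|.
  by rewrite -sum1_card; apply: leq_sum.
have lo : #|~: S| * (6 - #|~: S|) <= \sum_(x in ~: S) deg_in S x.
  rewrite -sum_nat_const; apply: leq_sum => x xX.
  by have := deg_in_cardS xX; have := deg_inC S x; rewrite regG D5; lia.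
rewrite sum_deg_in_swap in lo; have nE := cardsC S.
set m := #|~: S| in X1 lo nE *.
have : m * (6 - m) <= 9 - m by lia.
(* [S] contains [v] and its four neighbours. The values 2, 3 and 4 of m then violate the inequality
   above. *)
have : m <= 4 by lia.
by case: m X1 {lo nE} => [|[|[|[|[|m]]]]].
Qed.

Lemma num_exact_regular_near_top : D = 5 -> #|G| <= 9 ->
  num_exact G 3%:Z <= #|G|.
Proof.
move=> D5 n9; rewrite -cardsT -(card_imset _ set1_inj) -(card_imset _ (@setC_inj G)).
apply/subset_leq_card/subsetP => S; rewrite inE.
case/(exact_regular_near_top D5 n9)/eqP/cards1P => x e.
by rewrite -[S]setCK e; apply/imset_f/imset_f.
Qed.

End Regular.

(** * The graph G* under the assumption t > 0 *)

Section Mate.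
Variables (K : graph) (D t : nat).
Let H : {set K} := [set v | degree v == D + t].
Hypotheses (t_gt0 : 0 < t) (maxK : max_degree K = D + t) (cardL : #|~: H| = t).
(** The parity and the upper bound of the indices of a [D]-regular graph, shifted by the difference
    [t] of the orders. *)
Hypothesis indexK : forall k (S : {set K}), exact_alliance k S ->
  exists2 d, d <= D & k = ((2 * d)%:Z - (D + t)%:Z)%R.
(** The coefficient of the highest term is at most 1. *)
Hypothesis topK : forall S S' : {set K},
  exact_alliance (D%:Z - t%:Z)%R S -> exact_alliance (D%:Z - t%:Z)%R S' -> S = S'.

Implicit Types (X : {set K}) (u v : K).

(* The index D - t - 1 has the wrong parity, so a connected dense set has index
   D - t; sets need not be connected to be dense. *)
Definition dense X := forall v, v \in X -> D + degree v < 2 * deg_in X v + t + 2.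

(** By [indexK] the exact index of the component is at most D - t and has the parity of D - t, while
    density puts it above D - t - 2. *)
Lemma exact_component_dense X v : dense X -> v \in X ->
  exact_alliance (D%:Z - t%:Z)%R (component X v).
Proof.
move=> dX vX; have C0 : component X v != set0.
  by apply/set0Pn; exists v; apply: mem_component.
have [k kC [u uC ku]] := exists_exact_index C0 (connected_component vX).
have [d dD kd] := indexK kC.
have := dX u (subsetP (component_sub X v) u uC); rewrite -(deg_in_component uC) => du.
by rewrite (_ : D%:Z - _ = k)%R //; move: ku; rewrite /index_at; lia.
Qed.

Lemma degH v : v \in H -> degree v = D + t.
Proof. by rewrite inE => /eqP. Qed.

Lemma deg_in_H v : v \in H -> D <= deg_in H v.
Proof.
by move=> /degH dv; have := deg_inC H v; have := deg_in_card (~: H) v; rewrite cardL; lia.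
Qed.

Lemma dense_sub_H X : X \subset H -> {in X, forall v, D <= deg_in X v} -> dense X.
Proof. by move=> /subsetP s h v vX; rewrite (degH (s v vX)); have := h v vX; lia. Qed.

Lemma dense_H : dense H.
Proof. exact: (dense_sub_H (subxx H) deg_in_H). Qed.

(** All components of [H] are alliances of the top index, so they coincide by [topK]. *)
Lemma H_component v : v \in H -> component H v = H.
Proof.
move=> vH; apply/setP => x; apply/idP/idP => [|xH].
  exact: (subsetP (component_sub H v)).
have exC := exact_component_dense dense_H.
  by rewrite (topK (exC v vH) (exC x xH)) mem_component.
Qed.

Lemma exists_H : exists v, v \in H.
Proof.
have [v dv] := exists_max_degree K; exists v.
by rewrite inE dv maxK.
Qed.

Lemma exact_H : exact_alliance (D%:Z - t%:Z)%R H.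
Proof.
have [v vH] := exists_H.
by rewrite -(H_component vH); apply: exact_component_dense => //; apply: dense_H.
Qed.

Lemma connected_H : connected_in H.
Proof. by have := exact_H; rewrite exact_allianceE => /and4P[]. Qed.

Lemma dense_component X v : dense X -> v \in X -> component X v = H.
Proof. move=> dX vX; exact: topK (exact_component_dense dX vX) exact_H. Qed.

(** Mostly used by contraposition: a nonempty set missing a vertex of [H] is not dense, and
    [not_dense] then yields a vertex of low index. *)
Lemma dense_supset X v : dense X -> v \in X -> H \subset X.
Proof. by move=> dX vX; rewrite -(dense_component dX vX) component_sub. Qed.

Lemma dense_connected X v : dense X -> v \in X -> connected_in X -> X = H.
Proof.
move=> dX vX /forall_inP cX; rewrite -(dense_component dX vX); apply/setP => x.
by rewrite inE; have [xX|//] := boolP (x \in X); rewrite (forall_inP (cX v vX)).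
Qed.

Lemma not_dense X : ~ dense X ->
  exists2 v, v \in X & 2 * deg_in X v + t + 2 <= D + degree v.
Proof.
move=> nX; have [/exists_inP[v vX le]|no] :=
  boolP [exists v in X, 2 * deg_in X v + t + 2 <= D + degree v]; first by exists v.
by case: nX => v vX; rewrite ltnNge; apply: contra no => le; apply/exists_inP; exists v.
Qed.

Lemma deg_in_HD v : v \in H -> deg_in H v + deg_in (~: H) v = D + t.
Proof. by move=> vH; rewrite deg_inC degH. Qed.

(** Such a [v] is adjacent to all of L. If there were none, every vertex of [H] other than [v0]
    would keep at least [D] neighbours after deleting [v0], making [H :\ v0] dense. For [v0] outside
    [H], a vertex attaining the index D - t of [H] will do. *)
Lemma exists_full v0 : (0 < D) -> exists v, [&& v \in H, v != v0 & deg_in (~: H) v == t].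
Proof.
move=> D0; have [u uX] : exists u, u \in H :\ v0.
  have [v vH] := exists_H.
  have [->|nv] := eqVneq v0 v; last by exists v; rewrite in_setD1 eq_sym nv vH.
  have /card_gt0P[x] : 0 < deg_in H v by apply: leq_trans D0 (deg_in_H vH).
  rewrite inE => /andP[xH vx]; exists x; rewrite in_setD1 xH andbT.
  by apply: contraTneq vx => ->; rewrite adj_irrefl.
apply/existsP; apply: contraT => /existsPn no.
have dX : dense (H :\ v0).
  apply: dense_sub_H; first exact: subD1set.
  move=> v; rewrite in_setD1 => /andP[nv vH]; have := no v; rewrite vH nv /= => nt.
  have := deg_in_card (~: H) v; have := deg_in_HD vH; rewrite (deg_inD1 _ v0) cardL.
  by case: (_ && _) => /=; lia.
have [v0H|v0H] := boolP (v0 \in H).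
  by have /subsetP/(_ v0 v0H) := dense_supset dX uX; rewrite !inE eqxx.
have [v vH] := exists_H.
have := exact_H; rewrite exact_allianceE => /and4P[_ _ _ /exists_inP[x xH /eqP]].
rewrite /index_at (degH xH) => e; have := deg_in_HD xH => e'.
have := no x; rewrite xH /= (_ : x != v0); last by apply: contraNneq v0H => <-.
by move/eqP; lia.
Qed.

Lemma connected_H1 w : (0 < D) -> w \in ~: H -> connected_in (w |: H).
Proof.
move=> D0 wL; have [v /and3P[vH _ /eqP vt]] := exists_full w D0.
rewrite -cardL in vt.
by apply: (connected_setU1 connected_H vH); rewrite adj_sym (deg_in_full vt).
Qed.

(** Two applications of [exists_full] give two neighbours of [w] in [H]. For the upper bound,
    [w |: H] is connected and differs from [H], so it is not dense; vertices of [H] have index at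
    least D - t in it, so the low vertex is [w]. *)
Lemma deg_in_H_low w : (0 < D) -> w \in ~: H -> 2 <= deg_in H w <= D - 3.
Proof.
move=> D0 wL; apply/andP; split.
  have [v /and3P[vH _ /eqP vt]] := exists_full w D0.
  have [u /and3P[uH uv /eqP ut]] := exists_full v D0.
  rewrite -cardL in ut vt.
  rewrite (_ : 2 = #|[set u; v]|); last by rewrite cards2 uv.
  apply/subset_leq_card/subsetP => x /set2P[]->; rewrite inE ?uH ?vH adj_sym.
    by rewrite (deg_in_full ut).
  by rewrite (deg_in_full vt).
have nd : ~ dense (w |: H).
  move=> d; have /setP/(_ w) := dense_connected d (setU11 w H) (connected_H1 D0 wL).
  by rewrite setU11; move: wL; rewrite inE => /negPf ->.
have [v vX le] := not_dense nd.
have H1 : deg_in H v <= deg_in (w |: H) v by apply/deg_in_sub/subsetUr.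
case/setU1P: vX => [vw|vH]; last first.
  by have := deg_in_H vH; rewrite (degH vH) in le; lia.
subst v; have := deg_in_cardS wL; have := deg_inC H w; rewrite cardL.
lia.
Qed.

Lemma exists_low : 0 < D -> exists2 w, w \in ~: H & degree w + t + 2 <= D.
Proof.
move=> D0; have cT : connected_in [set: K].
  have [v vH] := exists_H.
  apply: (@connected_dominated _ _ v) => x _.
  (* Each vertex [x] shares with [v] a connected set formed by [H] and one vertex of L. *)
  have [w xw ] : exists2 w, x \in w |: H & connected_in (w |: H).
    have [xH|xL] := boolP (x \in H).
      have /card_gt0P[w wL] : 0 < #|~: H| by rewrite cardL.
      by exists w; [apply: setU1r|apply: connected_H1].
    by exists x; [rewrite setU11|apply: connected_H1; rewrite ?in_setC].
  move=> /forall_inP/(_ v)/(_ _)/forall_inP c.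
  have {c} := c (setU1r w vH) x xw; apply: connect_sub => y z /= /and3P[_ _ yz].
  by apply: connect1; rewrite /induced_adj /= !inE.
have /card_gt0P[w wL] : 0 < #|~: H| by rewrite cardL.
have nd : ~ dense setT.
  move=> d; have /setP/(_ w) := dense_connected d (in_setT w) cT.
  by rewrite inE; move: wL; rewrite inE => /negPf ->.
have [v _ le] := not_dense nd; rewrite -/(degree v) in le.
exists v; last by lia.
by rewrite inE; apply/negP => /degH; lia.
Qed.

(** If [D] were 0, then even a single vertex of L would be dense, as its degree is at most [t]. *)
Lemma D_gt0 : 0 < D.
Proof.
rewrite lt0n; apply/eqP => D0.
have /card_gt0P[w wL] : 0 < #|~: H| by rewrite cardL.
have dw : dense [set w].
  by move=> x _; have := degree_le_max x; rewrite maxK; lia.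
have [v vH] := exists_H.
have /set1P e := subsetP (dense_supset dw (set11 w)) v vH.
by move: wL; rewrite inE -e vH.
Qed.

(** The low vertex [w] has degree at least 2, so t + 4 <= D <= 5 with t positive. *)
Lemma mate_parameters : D <= 5 -> D = 5 /\ t = 1.
Proof.
move=> D5; have [w wL] := exists_low D_gt0.
have := deg_in_H_low D_gt0 wL; have := deg_in_le H w; lia.
Qed.

(** * The remaining case D = 5, t = 1 *)

Section Quintic.
Hypotheses (D5 : D = 5) (t1 : t = 1).

Lemma quintic_structure : exists w a b, [/\ ~: H = [set w], a \in H, b \in H,
  a != b & {in H, forall v, adj v w = (v == a) || (v == b)}].
Proof.
have /cards1P[w eL] : #|~: H| == 1 by rewrite cardL t1.
have wL : w \in ~: H by rewrite eL set11.
have /cards2P[a [b [ab eN]]] : #|[set x in H | adj w x]| == 2.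
  by have := deg_in_H_low D_gt0 wL; rewrite /deg_in D5 [_ == 2]eqn_leq andbC.
have N v : (v \in H) && adj v w = (v == a) || (v == b).
  by have /setP/(_ v) := eN; rewrite in_set in_set2 adj_sym.
exists w, a, b; split=> // [||v vH]; last by rewrite -N vH.
- by have := N a; rewrite eqxx => /andP[].
by have := N b; rewrite eqxx orbT => /andP[].
Qed.

Variables w a b : K.
Hypotheses (eL : ~: H = [set w]) (aH : a \in H) (bH : b \in H) (nab : a != b).
Hypothesis adjw : {in H, forall v, adj v w = (v == a) || (v == b)}.

Lemma deg_in_H6 v : v \in H -> deg_in H v + ((v == a) || (v == b)) = 6.
Proof. by move=> vH; have := deg_in_HD vH; rewrite eL deg_in1 adjw // D5 t1. Qed.

Lemma deg_in_H1 u v : v \in H -> u \in H ->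
  deg_in (H :\ u) v + adj v u + ((v == a) || (v == b)) = 6.
Proof.
by move=> vH uH; rewrite -(deg_in_H6 vH) [deg_in H v](deg_inD1 _ u) uH; lia.
Qed.

Lemma ab_dominating u : u \in H -> adj u a || adj u b.
Proof.
move=> uH; have [x xX] : exists x, x \in H :\ u.
  have [ua|] := eqVneq u a; last by exists a; rewrite in_setD1 eq_sym aH andbT.
  by exists b; rewrite in_setD1 ua eq_sym nab.
have nd : ~ dense (H :\ u).
  by move=> d; have := subsetP (dense_supset d xX) u uH; rewrite in_setD1 eqxx.
have [v] := not_dense nd; rewrite in_setD1 => /andP[vu vH].
rewrite (degH vH) D5 t1 => le; have := deg_in_H1 vH uH.
(* The vertex [v] has at most 4 neighbours in [H :\ u], so both corrections in [deg_in_H1] must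
   occur. *)
have : (adj v u) && ((v == a) || (v == b)).
  by have := deg_in_H1 vH uH; case: (adj v u); case: (_ || _) => //=; lia.
by rewrite adj_sym => /andP[vu' /orP[]/eqP <-]; rewrite vu' ?orbT.
Qed.

Lemma adj_ab : adj a b.
Proof. by have := ab_dominating aH; rewrite adj_irrefl. Qed.

(** A vertex of [H] other than [a] and [b] has six neighbours in [H]; one of low index in
    [H :\ b :\ a] keeps at most four, so it has lost both [a] and [b]. *)
Lemma common_neighbor : exists2 c, c \in H & adj a c && adj b c.
Proof.
have := deg_in_H1 aH bH; rewrite adj_ab eqxx /= => da.
have /card_gt0P[x] : 0 < deg_in (H :\ b) a by lia.
rewrite inE => /andP[xb ax]; have xX : x \in H :\ b :\ a.
  by rewrite in_setD1 xb andbT; apply: contraTneq ax => ->; rewrite adj_irrefl.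
have nd : ~ dense (H :\ b :\ a).
  by move=> d; have := subsetP (dense_supset d xX) a aH; rewrite in_setD1 eqxx.
have [c] := not_dense nd; rewrite !in_setD1 => /and3P[ca cb cH].
rewrite (degH cH) D5 t1 => le; exists c => //.
have := deg_in_H1 cH bH; rewrite (deg_inD1 _ a) in_setD1 nab aH /= (negPf ca) (negPf cb) /=.
rewrite ![adj _ c]adj_sym.
by case: (adj c a); case: (adj c b) => //=; lia.
Qed.

(** The neighbourhoods of [a] and [b] in [H] have five elements each, cover [H] and intersect. *)
Lemma card_H_le9 : #|H| <= 9.
Proof.
pose N x := [set y in H | adj x y].
have memN x y : (y \in N x) = (y \in H) && adj x y by rewrite in_set.
have Na : #|N a| = 5 by have := deg_in_H6 aH; rewrite eqxx /deg_in -/(N a); lia.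
have Nb : #|N b| = 5 by have := deg_in_H6 bH; rewrite eqxx orbT /deg_in -/(N b); lia.
have [c cH /andP[ac bc]] := common_neighbor.
have I0 : 0 < #|N a :&: N b| by apply/card_gt0P; exists c; rewrite in_setI !memN cH ac bc.
have le : #|H| <= #|N a :|: N b|.
  apply/subset_leq_card/subsetP => x xH; have := ab_dominating xH.
  by rewrite in_setU !memN xH ![adj x _]adj_sym.
by have := cardsUI (N a) (N b); lia.
Qed.

(** The flag [c] decides whether [w] is in the set. The edge between [a] and [b] dominates the set,
    so it is connected. Vertices of [H] keep at least 4 of their 6 neighbours, and [w] keeps both of
    its own. *)
Lemma exact_setD1 (c : bool) u : u \in H :\ a :\ b ->
  exact_alliance 2%:Z ((if c then setT else H) :\ u).
Proof.
rewrite !in_setD1 => /and3P[ub ua uH].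
set S := _ :\ u.
have HS : H :\ u \subset S by apply: setSD; case: c @S => _; rewrite ?subsetT.
have aS : a \in S by rewrite (subsetP HS) // in_setD1 eq_sym ua.
have bS : b \in S by rewrite (subsetP HS) // in_setD1 eq_sym ub.
have notH v : v \notin H -> v = w by rewrite -in_setC eL => /set1P.
have dw : degree w = 2.
  have wL : w \in ~: H by rewrite eL set11.
  have := deg_inC H w; rewrite eL deg_in1 adj_irrefl.
  by have := deg_in_H_low D_gt0 wL; rewrite D5; lia.
have wu : adj w u = false by rewrite adj_sym adjw // (negPf ua) (negPf ub).
rewrite exact_allianceE; apply/and4P; split.
- by apply/set0Pn; exists a.
- apply: (connected_edge_dominated aS bS adj_ab) => v vS.
  have [/ab_dominating //|/notH ->] := boolP (v \in H).
  by rewrite adj_sym adjw // eqxx.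
- apply/forall_inP => v vS; have [vH|/notH vw] := boolP (v \in H).
    have := deg_in_H1 vH uH; have := deg_in_sub v HS; rewrite /index_at (degH vH) D5 t1.
    by case: (adj v u); case: (_ || _) => /=; lia.
  have Sw : deg_in S w = 2.
    move: vS; rewrite vw /S; case: (c) => [_|].
      by rewrite -dw /degree [in RHS](deg_inD1 _ u) wu andbF.
    by rewrite in_setD1 => /andP[_ wH]; have := set11 w; rewrite -eL inE wH.
  by rewrite vw /index_at Sw dw.
(* Index 2 is attained at [w] if it is present, and otherwise at a neighbour of [u] among [a] and
   [b]. *)
apply/exists_inP; case: c @S HS aS bS => S HS aS bS.
  exists w; first by rewrite /S in_setD1 in_setT andbT; apply: contraTneq uH => <-;
    rewrite -in_setC eL set11.
  have Sw : deg_in S w = 2 by rewrite -dw /degree [in RHS](deg_inD1 _ u) wu andbF.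
  by rewrite /index_at Sw dw.
have [x xS [xu xab]] : exists2 x, x \in S & adj u x /\ ((x == a) || (x == b)).
  by case/orP: (ab_dominating uH); [exists a|exists b]; rewrite ?eqxx ?orbT.
have xH : x \in H by move: xS; rewrite in_setD1 => /andP[].
have dx : deg_in S x = 4.
  have := deg_in_H1 xH uH; rewrite adj_sym xu xab !addn1.
  by case.
by exists x; rewrite // /index_at dx (degH xH) D5 t1.
Qed.

Lemma num_exact2_ge : 2 * (#|H| - 2) <= num_exact K 2%:Z.
Proof.
have cX : #|H :\ a :\ b| = #|H| - 2.
  have := cardsD1 a H; have := cardsD1 b (H :\ a).
  by rewrite in_setD1 eq_sym nab aH bH; lia.
pose f (p : bool * K) := (if p.1 then setT else H) :\ p.2.
have finj : {in setX setT (H :\ a :\ b) &, injective f}.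
  move=> [c u] [d v]; rewrite !in_setX !in_setT /= => uX vX e.
  have uH : u \in H by move: uX; rewrite !in_setD1 => /and3P[].
  have vH : v \in H by move: vX; rewrite !in_setD1 => /and3P[].
  have wH : w \notin H by rewrite -in_setC eL set11.
  (* Membership of [w] recovers the flag, and [u] is the only vertex of [H] missing. *)
  congr pair.
    have /setP/(_ w) := e; rewrite !in_setD1.
    have -> : w != u by apply: contraNneq wH => ->.
    have -> : w != v by apply: contraNneq wH => ->.
    by case: c {e}; case: d; rewrite ?in_setT ?(negPf wH).
  have /setP/(_ u) := e; rewrite !in_setD1 eqxx /=.
  by case: d {e}; rewrite ?in_setT ?uH andbT => /esym/negbFE/eqP.
have := card_in_imset finj; rewrite cardsX cardsT card_bool cX => <-.
apply/subset_leq_card/subsetP => S /imsetP[[c u]]; rewrite in_setX in_setT /= => uX ->.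
by rewrite inE; apply: exact_setD1.
Qed.

(** As [a] has five neighbours in [H], there are at least 6 vertices in [H], and n < 2(n - 2) for n
    > 4. *)
Lemma card_H_lt_num_exact2 : #|H| < num_exact K 2%:Z.
Proof.
have := num_exact2_ge; have := deg_in_H6 aH; rewrite eqxx.
by have := deg_in_cardS aH; lia.
Qed.

End Quintic.

End Mate.

(** * Comparison of the two polynomials *)

Theorem theorem3p4 (Delta : nat) (G Gstar : graph) :
  connected G -> regular G Delta -> (Delta <= 5)%N ->
  alliance_poly Gstar = alliance_poly G ->
  regular Gstar Delta /\ #|Gstar| = #|G| /\ #|edges Gstar| = #|edges G|.
Proof.
move=> cG regG D5 eP.
have eN (z : int) : num_exact Gstar (z - #|Gstar|%:Z)%R = num_exact G (z - #|G|%:Z)%R.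
  have [z0|z0] := lerP 0%R z.
    have := congr1 (fun p : {poly int} => p`_(absz z))%R eP.
    by rewrite !coef_alliance_poly gez0_abs // => /eqP; rewrite Num.Theory.eqr_nat => /eqP.
  (* Indices exceed minus the order, so a negative exponent [z] never occurs. *)
  have neg (X : graph) : num_exact X (z - #|X|%:Z)%R = 0.
    apply/eqP; rewrite -leqn0 leqNgt num_exact_gt0; apply/existsP => -[S].
    rewrite exact_allianceE => /and4P[_ _ _ /exists_inP[v _ /eqP]].
    by have := degree_le_max v; have := max_degree_lt X; rewrite /index_at; lia.
  by rewrite !neg.
have maxG := max_degree_regular regG.
have num_min : num_exact G (- Delta%:Z)%R = #|G|.
  rewrite -maxG num_exact_min_degree -cardsT; apply: eq_card => v.
  by rewrite !inE regG maxG eqxx.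
have eK k j : (k + #|Gstar|%:Z - #|G|%:Z)%R = j -> num_exact Gstar k = num_exact G j.
  by move=> <-; rewrite -eN; congr num_exact; lia.
have exK k (S : {set Gstar}) : exact_alliance k S ->
    exists2 d, d <= Delta & (k + #|Gstar|%:Z - #|G|%:Z)%R = ((2 * d)%:Z - Delta%:Z)%R.
  move=> ex; have : 0 < num_exact Gstar k by rewrite num_exact_gt0; apply/existsP; exists S.
  by rewrite (eK _ _ erefl) num_exact_gt0 => /existsP[S']; apply: exact_regular.
pose H := [set v : Gstar | degree v == max_degree Gstar].
(* The lowest index of each graph is attained; comparing the lowest exponents gives one inequality
   from each side. *)
have maxK : ((max_degree Gstar)%:Z = Delta%:Z + #|Gstar|%:Z - #|G|%:Z)%R.
  have G0 := vertex_nonempty G.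
  have : 0 < num_exact Gstar (- Delta%:Z + #|G|%:Z - #|Gstar|%:Z)%R.
    by rewrite (eK _ (- Delta%:Z)%R) ?num_min //; lia.
  rewrite num_exact_gt0 => /existsP[S]; rewrite exact_allianceE.
  case/and4P=> _ _ _ /exists_inP[v _ /eqP]; have := degree_le_max v.
  rewrite /index_at => e1 e2.
  have : 0 < num_exact Gstar (- (max_degree Gstar)%:Z)%R.
    rewrite num_exact_min_degree; apply/card_gt0P.
    by have [u du] := exists_max_degree Gstar; exists u; rewrite inE du.
  by rewrite num_exact_gt0 => /existsP[S' /exK[d _]]; lia.
have cardH : #|H| = #|G|.
  by rewrite -num_exact_min_degree (eK _ (- Delta%:Z)%R) //; lia.
have cL := cardsC H.
have [t0|t0] := posnP #|~: H|.
  have en : #|Gstar| = #|G| by lia.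
  have regK : regular Gstar Delta.
    move=> v; have : v \notin ~: H by rewrite (cards0_eq t0) inE.
    by rewrite !inE negbK => /eqP ->; lia.
  split=> //; split=> //; have := handshake G; have := handshake Gstar.
  rewrite (eq_bigr (fun=> Delta)) // [X in _ -> X = _ -> _](eq_bigr (fun=> Delta)) //.
  by rewrite !sum_nat_const !cardT -!cardE en => -> /eqP; rewrite eqn_pmul2l // => /eqP.
pose t := #|~: H|; have maxt : max_degree Gstar = Delta + t by rewrite /t; lia.
have eH : H = [set v | degree v == Delta + t] by rewrite /H maxt.
have cLt : #|~: [set v : Gstar | degree v == Delta + t]| = t by rewrite -eH.
have idx k (S : {set Gstar}) : exact_alliance k S ->
    exists2 d, d <= Delta & k = ((2 * d)%:Z - (Delta + t)%:Z)%R.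
  by case/exK => d dD e; exists d => //; rewrite /t; lia.
have top (S S' : {set Gstar}) : exact_alliance (Delta%:Z - t%:Z)%R S ->
    exact_alliance (Delta%:Z - t%:Z)%R S' -> S = S'.
  have : num_exact Gstar (Delta%:Z - t%:Z)%R <= 1.
    rewrite (eK _ Delta%:Z%R); last by rewrite /t; lia.
    rewrite -(cards1 [set: G]); apply/subset_leq_card/subsetP => X.
    by rewrite !inE => /(exact_regular_top regG cG)/eqP.
  by move=> /card_le1_eqP le1 e e'; apply: le1; rewrite inE.
have [eD et] := mate_parameters t0 maxt cLt idx top D5.
have [w [a [b [eL aH bH nab adjw]]]] := quintic_structure t0 maxt cLt idx top eD et.
have := card_H_le9 t0 maxt cLt idx top eD et eL aH bH nab adjw.
have := card_H_lt_num_exact2 t0 maxt cLt idx top eD et eL aH bH nab adjw.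
(* The orders differ by t = 1, so index 2 in G* corresponds to index 3 in G. *)
rewrite -eH cardH (eK _ 3%:Z%R); last by lia.
by move=> gt n9; have := num_exact_regular_near_top regG eD n9; rewrite leqNgt gt.
Qed.
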